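(* The integer group determinants of $GA(1,27)$ are exactly the integers of the form $$D=AB^{26},\qquad A,B\in\mathbb Z,$$ where $B\equiv A\pmod{27}$ and $A$ satisfies: if $2\mid A$ then $4\mid A$, and if $13\mid A$ then $13^2\mid A$.
   Context: For a finite group $G=\{g_1,\dots,g_n\}$ and an element $\sum_{g\in G}a_g g$ of the group ring $\mathbb Z[G]$ (all $a_g\in\mathbb Z$), the group determinant is $D\left(\sum_{g\in G}a_g g\right)=\det\left(a_{g_ig_j^{-1}}\right)_{i,j=1}^n$. An integer group determinant of $G$ is any integer of this form. The general affine group of degree one over $\mathbb F_{27}$ is $GA(1,27)=\left\{\begin{pmatrix} a & b\\ 0 & 1\end{pmatrix}: a\in\mathbb F_{27}^*,\ b\in\mathbb F_{27}\right\}$ under matrix multiplication (a group of order $702$). *)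

(* Defs.v *)
From HB Require Import structures.
From mathcomp Require Import all_boot all_order all_algebra all_fingroup.
Set Implicit Arguments. Unset Strict Implicit. Unset Printing Implicit Defensive.
Import GRing.Theory.
Local Open Scope ring_scope.

Definition int_group_det (gT : finGroupType) (G : {set gT}) (a : gT -> int) : int :=
  \det (\matrix_(i < #|G|, j < #|G|) a (enum_val i * (enum_val j)^-1)%g).

Definition is_int_group_det (gT : finGroupType) (G : {set gT}) (D : int) : Prop :=
  exists a : gT -> int, D = int_group_det G a.

(* GA(1,F): the matrices [[a, b], [0, 1]] with a in F^*, b in F,
   as a subgroup of GL_2(F). *)
Definition GA1 (F : finFieldType) : {set {'GL_2[F]}} :=
  [set g : {'GL_2[F]} | (GLval g ord_max ord0 == 0) && (GLval g ord_max ord_max == 1)].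

(* Main.v *)
Require Import Defs.
From HB Require Import structures.
From mathcomp Require Import all_boot all_order all_algebra all_fingroup.
From mathcomp Require Import all_solvable all_field all_character.
From mathcomp Require Import ring zify.
Set Implicit Arguments. Unset Strict Implicit. Unset Printing Implicit Defensive.
Import Order.TTheory GRing.Theory FinRing.Theory Num.Theory.
Local Open Scope ring_scope.

(* Write V for the translations of GA(1,F) and H = F^* for the complement.  Left
   multiplication on Z[V]^H turns an element of the group ring into an H x H matrix
   over the commutative ring Z[V]; let delta in Z[V] be its determinant.  The group
   determinant is the product of psi(delta) over the characters psi of V.  The trivial
   character gives the determinant A of the image in Z[H], and H permutes the others
   transitively, so they all give the same value B.  Fourier inversion yields
   A - B = |F| * delta(1), where delta(1) is an integer, so B = A mod 27.

   H is cyclic of order 26, so A = prod_k f(w^k) is a circulant determinant.  It is the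
   product of two circulants of size 13, attached to f(x) and f(-x), which agree mod 2;
   and it is the circulant of size 13 attached to f(x)f(-x), where 13 | det forces
   13 | f(1) f(-1), after which adding up rows and columns produces a factor 13^2.

   Conversely, if C is the circulant of an element of Z[H] and N is any integer 26 x 26
   matrix, some element of Z[GA(1,27)] has A = det C and B = det(C + 27 N).  So it is
   enough to find a circulant C of determinant A that can be lifted from Z/27 with
   determinant B.  All C used here satisfy C = C0 (1 + z J) mod 27, with J the all-ones
   matrix and det C0 = 1 mod 27; C0 lifts to a matrix of determinant 1, while 1 + z J
   lifts to identity + rank one, whose determinant can be any integer congruent to 1 + 26 z mod 27. *)

(** * Characters and block determinants *)

(** Two enumerations differ by one permutation, applied to rows and columns alike, so its sign
    enters squared. This frees the group determinant from the fixed enumeration of [GA1 F]. *)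
Lemma det_reindex (R : comPzRingType) (T : Type) (m n : nat) (e : 'I_m -> T)
    (e' : 'I_n -> T) (f : T -> T -> R) : bijective e -> bijective e' ->
  \det (\matrix_(i, j) f (e i) (e j)) = \det (\matrix_(i, j) f (e' i) (e' j)).
Proof.
move=> [d ed de] [d' ed' de'].
have mn : m = n.
  have /bij_eq_card : bijective (d' \o e).
    by exists (d \o e') => i /=; rewrite ?de' ?ed ?de ?ed'.
  by rewrite !card_ord.
case: n / mn e' d' ed' de' => e' d' ed' de'.
have h_inj : injective (d \o e') by apply: (can_inj (g := d' \o e)) => i /=; rewrite de ed'.
pose s := perm h_inj.
have -> : \matrix_(i, j) f (e' i) (e' j) =
    row_perm s (col_perm s (\matrix_(i, j) f (e i) (e j))).
  by apply/matrixP => i j; rewrite !mxE !permE /= !de.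
rewrite row_permE col_permE !det_mulmx !det_perm odd_permV.
by rewrite mulrCA -signr_addb addbb mulr1.
Qed.

Lemma det_mxdiag (R : comNzRingType) (m : nat) (p_ : 'I_m -> nat)
    (B_ : forall i, 'M[R]_(p_ i)) : \det (\mxdiag_i B_ i) = \prod_i \det (B_ i).
Proof.
elim: m p_ B_ => [|m IHm] q_ B_.
  by move: (mxdiag _); rewrite !big_ord0 => M; rewrite det_mx00.
rewrite mxdiag_recl [RHS]big_ord_recl/= -IHm.
by case: _ / mxsize_recl; rewrite ?castmx_id det_ublock.
Qed.

(** The vanishing sum encodes nontriviality, in the form that orthogonality needs. *)
Definition nontrivial_character (F : finFieldType) (psi : F -> algC) :=
  [/\ psi 0 = 1, {morph psi : x y / x + y >-> x * y} & \sum_x psi x = 0].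

Lemma exists_nontrivial_character (F : finFieldType) :
  exists psi : F -> algC, nontrivial_character psi.
Proof.
pose G : {group F} := [set: F]%G.
have abG : abelian G by apply/centsP => x _ y _; rewrite /commute !zmodMgE addrC.
have : (0 < #|[set~ (0%R : Iirr G)]|)%N.
  rewrite cardsC1 (card_Iirr_abelian abG) cardsT.
  by rewrite -ltnS prednK ?(ltnW (finNzRing_gt1 _)) // finNzRing_gt1.
case/card_gt0P => i; rewrite !inE => i_neq0.
have lin_i : 'chi_i \is a linear_char by apply: (char_abelianP G abG).
exists (fun x => 'chi_i x); split=> [|x y|].
- exact: (lin_char1 lin_i).
- by rewrite -(lin_charM lin_i) ?inE.
have := cfdot_irr i 0; rewrite (negbTE i_neq0) cfdotE irr0 => /eqP.
rewrite mulf_eq0 invr_eq0 (negbTE (neq0CG _)) /= => /eqP sum0; rewrite -[RHS]sum0.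
by apply: eq_big => [x|x _]; rewrite ?inE // cfun1E inE conjC1 mulr1.
Qed.

Section Character.
Variables (F : finFieldType) (psi : F -> algC).
Hypothesis psiP : nontrivial_character psi.

Lemma character0 : psi 0 = 1. Proof. by case: psiP. Qed.
Lemma characterD x y : psi (x + y) = psi x * psi y. Proof. by case: psiP. Qed.

Lemma sum_characterM (z : F) : \sum_x psi (x * z) = (#|F| * (z == 0))%:R.
Proof.
have [->|z_neq0] := eqVneq z 0.
  under eq_bigr do rewrite mulr0 character0.
  by rewrite sumr_const muln1.
case: psiP => _ _; rewrite (reindex_inj (mulIf z_neq0)) => ->.
by rewrite muln0.
Qed.

Lemma character_orthogonality (y z : F) :
  \sum_x psi (x * y) * psi (- (x * z)) = (#|F| * (y == z))%:R.
Proof.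
rewrite -subr_eq0 -sum_characterM; apply: eq_bigr => x _.
by rewrite -characterD mulrBr.
Qed.

(** The Fourier transform in the [F] coordinate turns convolution into multiplication, hence
    conjugates the matrix into one block for each character [fun b => psi (b * y)]. *)
Lemma det_character_blocks (n N : nat) (f : 'I_n -> 'I_n -> F -> algC)
    (e : 'I_N -> F * 'I_n) : bijective e ->
  \det (\matrix_(k, l) f (e k).2 (e l).2 ((e k).1 - (e l).1)) =
  \prod_(y : F) \det (\matrix_(i, j) \sum_b f i j b * psi (b * y)).
Proof.
move=> e_bij.
pose p_ (_ : 'I_#|F|) := n.
pose e' (k : 'I_(\sum_y p_ y)) : F * 'I_n := (enum_val (tagnat.sig1 k), tagnat.sig2 k).
have e'_bij : bijective e'.
  exists (fun u => @tagnat.Rank _ p_ (enum_rank u.1) u.2).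
    by move=> k; rewrite /e' /= enum_valK tagnat.sig2K.
  case=> y i; rewrite /e' /= tagnat.Rank1K enum_rankK; congr (_, _).
  by apply: val_inj; rewrite tagnat.Rank2K; case: _ / esym.
rewrite (det_reindex (fun u v => f u.2 v.2 (u.1 - v.1)) e_bij e'_bij).
set K := \matrix_(_, _) _.
pose m (y : F) : 'M[algC]_n := \matrix_(i, j) \sum_b f i j b * psi (b * y).
pose Dg := \mxdiag_(y < #|F|) (m (enum_val y) : 'M_(p_ y)).
(* [X] is the Fourier transform on [F] tensored with the identity, and [Y] is its inverse up to the
   factor [#|F|]; [Y] serves only to show that [\det X] is nonzero. *)
pose X : 'M[algC]_(\sum_y p_ y) :=
  \matrix_(k, l) (((e' k).2 == (e' l).2)%:R * psi ((e' l).1 * (e' k).1)).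
pose Y : 'M[algC]_(\sum_y p_ y) :=
  \matrix_(k, l) (((e' k).2 == (e' l).2)%:R * psi (- ((e' k).1 * (e' l).1))).
have sum_e' (h : F * 'I_n -> algC) : \sum_k h (e' k) = \sum_y \sum_i h (y, i).
  rewrite pair_big (reindex e') /=; last exact/onW_bij.
  by apply: eq_bigr.
have XE k l : X k l = ((e' k).2 == (e' l).2)%:R * psi ((e' l).1 * (e' k).1).
  by rewrite mxE.
have YE k l : Y k l = ((e' k).2 == (e' l).2)%:R * psi (- ((e' k).1 * (e' l).1)).
  by rewrite mxE.
have KE k l : K k l = f (e' k).2 (e' l).2 ((e' k).1 - (e' l).1).
  by rewrite mxE.
have XY : X *m Y = #|F|%:R%:M.
  apply/matrixP => k l; rewrite [LHS]mxE [RHS]mxE -(inj_eq (bij_inj e'_bij)).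
  rewrite (eq_bigr _ (fun j _ => congr2 _ (XE k j) (YE j l))).
  rewrite (sum_e' (fun u => ((e' k).2 == u.2)%:R * psi (u.1 * (e' k).1) *
    ((u.2 == (e' l).2)%:R * psi (- (u.1 * (e' l).1))))).
  case: (e' k) (e' l) => [y i] [z j] /=.
  transitivity (\sum_x psi (x * y) * psi (- (x * z)) * (i == j)%:R).
    apply: eq_bigr => x _; rewrite (bigD1 i) //= eqxx mul1r big1 ?addr0.
      by rewrite mulrCA mulrC.
    by move=> i' /negbTE; rewrite eq_sym => ->; rewrite !mul0r.
  rewrite -mulr_suml character_orthogonality xpair_eqE.
  by case: (y == z); case: (i == j);
    rewrite ?(muln0, muln1, mulr0, mulr1, mulr0n, mulr1n).
have DgE k l : Dg k l =
    ((e' k).1 == (e' l).1)%:R *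
      \sum_b f (e' k).2 (e' l).2 b * psi (b * (e' k).1).
  rewrite mxE /= (inj_eq enum_val_inj).
  by case: eqP => _; rewrite ?conform_mx_id ?mul1r ?mul0r mxE.
have XK : X *m K = Dg *m X.
  apply/matrixP => k l; rewrite [LHS]mxE [RHS]mxE.
  rewrite (eq_bigr _ (fun j _ => congr2 _ (XE k j) (KE j l))).
  rewrite [RHS](eq_bigr _ (fun j _ => congr2 _ (DgE k j) (XE j l))).
  rewrite (sum_e' (fun u => ((e' k).2 == u.2)%:R * psi (u.1 * (e' k).1) *
    f u.2 (e' l).2 (u.1 - (e' l).1))).
  rewrite (sum_e' (fun u => ((e' k).1 == u.1)%:R *
    (\sum_b f (e' k).2 u.2 b * psi (b * (e' k).1)) *
    ((u.2 == (e' l).2)%:R * psi ((e' l).1 * u.1)))).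
  case: (e' k) (e' l) => [y i] [b' j] /=.
  transitivity (\sum_b psi (b * y) * f i j (b - b')).
    apply: eq_bigr => b _; rewrite (bigD1 i) //= eqxx mul1r big1 ?addr0 //.
    by move=> i' /negbTE; rewrite eq_sym => ->; rewrite !mul0r.
  rewrite [RHS](bigD1 y) //= eqxx [X in _ = _ + X]big1 ?addr0; last first.
    move=> z /negbTE; rewrite eq_sym => ->.
    by apply: big1 => i' _; rewrite !mul0r.
  rewrite [RHS](bigD1 j) //= eqxx [X in _ = _ + X]big1 ?addr0; last first.
    by move=> i' /negbTE ->; rewrite mul0r mulr0.
  rewrite !mul1r mulr_suml (reindex_inj (addIr b')).
  apply: eq_bigr => b _; rewrite addrK mulrDl characterD.
  by rewrite mulrC mulrA.
have detX : \det X != 0.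
  have : \det (X *m Y) != 0.
    by rewrite XY det_scalar expf_neq0 // pnatr_eq0 -lt0n; apply/card_gt0P; exists 0.
  by rewrite det_mulmx mulf_eq0 negb_or => /andP[].
apply: (mulfI detX); rewrite -det_mulmx XK det_mulmx mulrC; congr (_ * _).
rewrite det_mxdiag (reindex (fun i : 'I_#|F| => enum_val i)) //=.
exact/onW_bij/enum_val_bij.
Qed.

End Character.

(** * Fourier inversion and the isotypic blocks *)

Section Fourier.
Variables (F : finFieldType) (psi : F -> algC).
Hypothesis psiP : nontrivial_character psi.

(** Fourier transforms of integer-valued functions form a ring, products coming from convolutions,
    and the Leibniz formula stays inside it. One [delta] thus serves all [y]. *)
Lemma det_fourier_int (n : nat) (f : 'I_n -> 'I_n -> F -> int) :
  exists delta : F -> int, forall y,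
    \det (\matrix_(i, j) \sum_b (f i j b)%:~R * psi (b * y)) =
    \sum_x (delta x)%:~R * psi (x * y).
Proof.
pose isF (phi : F -> algC) := exists delta : F -> int,
  forall y, phi y = \sum_x (delta x)%:~R * psi (x * y).
have isF_const (c : int) : isF (fun=> c%:~R).
  exists (fun x => c *+ (x == 0)) => y.
  rewrite (bigD1 0) //= eqxx mul0r (character0 psiP) mulr1 big1 ?addr0 //.
  by move=> x /negbTE ->; rewrite mul0r.
have isF_add phi phi' : isF phi -> isF phi' -> isF (fun y => phi y + phi' y).
  move=> [d Dphi] [d' Dphi']; exists (fun x => d x + d' x) => y.
  by rewrite Dphi Dphi' -big_split; apply: eq_bigr => x _; rewrite rmorphD mulrDl.
have isF_mul phi phi' : isF phi -> isF phi' -> isF (fun y => phi y * phi' y).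
  move=> [d Dphi] [d' Dphi']; exists (fun x => \sum_z d (x - z) * d' z) => y.
  rewrite Dphi Dphi' mulr_sumr.
  transitivity (\sum_z \sum_x (d (x - z) * d' z)%:~R * psi (x * y)); last first.
    by rewrite exchange_big; apply: eq_bigr => x _; rewrite -mulr_suml rmorph_sum.
  apply: eq_bigr => z _; rewrite mulr_suml (reindex_inj (addIr (- z))) /=.
  apply: eq_bigr => x _; rewrite rmorphM mulrACA -(characterD psiP).
  by rewrite -mulrDl subrK.
have ext phi phi' : phi =1 phi' -> isF phi -> isF phi'.
  by move=> Ephi [d Dphi]; exists d => y; rewrite -Ephi.
have isF_sum (I : finType) (phi : I -> F -> algC) :
    (forall i, isF (phi i)) -> isF (fun y => \sum_i phi i y).
  move=> phiP; elim: (index_enum I) => [|i r IH].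
    by apply: ext (isF_const 0) => y; rewrite big_nil.
  by apply: ext (isF_add _ _ (phiP i) IH) => y; rewrite big_cons.
have isF_prod (I : finType) (phi : I -> F -> algC) :
    (forall i, isF (phi i)) -> isF (fun y => \prod_i phi i y).
  move=> phiP; elim: (index_enum I) => [|i r IH].
    by apply: ext (isF_const 1) => y; rewrite big_nil.
  by apply: ext (isF_mul _ _ (phiP i) IH) => y; rewrite big_cons.
(* Here the determinant unfolds to its Leibniz expansion: a sum over permutations of a sign times a
   product of entries. *)
apply: isF_sum => s; apply: isF_mul.
  by apply: ext (isF_const ((-1) ^+ s)) => y; rewrite rmorphXn rmorphN1.
by apply: isF_prod => i; exists (f i (s i)) => y; rewrite mxE.
Qed.

Lemma fourier_inversion (delta : F -> int) (x : F) :
  \sum_y (\sum_z (delta z)%:~R * psi (z * y)) * psi (- (x * y)) =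
  (#|F|%:Z * delta x)%:~R.
Proof.
transitivity (\sum_z (delta z)%:~R * (\sum_y psi (y * z) * psi (- (y * x)))).
  under eq_bigr do rewrite mulr_suml.
  rewrite exchange_big; apply: eq_bigr => z _; rewrite mulr_sumr.
  by apply: eq_bigr => y _; rewrite mulrA ![y * _]mulrC.
rewrite (bigD1 x) //= (character_orthogonality psiP) eqxx muln1 big1 ?addr0.
  by rewrite mulrC rmorphM.
by move=> z /negbTE xz; rewrite (character_orthogonality psiP) xz muln0 mulr0.
Qed.

Section Isotypic.
Variables (n : nat) (e : 'I_n -> {unit F}).
Hypothesis e_bij : bijective e.
Variable al : {unit F} -> F -> int.

(* Row i carries the substitution b |-> e i * b because GA(1,F) is indexed by the
   products (e i)(translation by b). *)
Definition isotypic_mx (y : F) : 'M[algC]_n :=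
  \matrix_(i, j) \sum_b (al (e i * (e j)^-1)%g (val (e i) * b))%:~R * psi (b * y).

Definition abelianized_mx : 'M[int]_n :=
  \matrix_(i, j) \sum_b al (e i * (e j)^-1)%g b.

Lemma isotypic_mx0 : isotypic_mx 0 = map_mx intr abelianized_mx.
Proof.
apply/matrixP => i j; rewrite !mxE rmorph_sum.
rewrite [RHS](reindex_inj (mulfI (_ : val (e i) != 0))) /=.
  by apply: eq_bigr => b _; rewrite mulr0 (character0 psiP) mulr1.
by rewrite -unitfE (valP (e i)).
Qed.

(** The substitution of [b * y] for [b] is absorbed by translating all of [F^*] by [u^-1], which
    leaves the quotients of its elements unchanged and only reorders rows and columns. *)
Lemma det_isotypic_mx (y : F) : y != 0 -> \det (isotypic_mx y) = \det (isotypic_mx 1).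
Proof.
move=> y_neq0; have y_unit : y \is a GRing.unit by rewrite unitfE.
pose u : {unit F} := Sub y y_unit.
pose phi (h k : {unit F}) := \sum_b (al (h * k^-1)%g (val h * b))%:~R * psi b.
have -> : isotypic_mx 1 = \matrix_(i, j) phi (e i) (e j).
  by apply/matrixP => i j; rewrite !mxE; apply: eq_bigr => b _; rewrite mulr1.
have -> : isotypic_mx y = \matrix_(i, j) phi (e i * u^-1)%g (e j * u^-1)%g.
  apply/matrixP => i j; rewrite !mxE /phi [RHS](reindex_inj (mulIf y_neq0)) /=.
  apply: eq_bigr => b _; rewrite invMg invgK mulgA mulgKV.
  by rewrite [b * y]mulrC mulrA mulrVK.
apply: det_reindex => //.
case: e_bij => d ed de; exists (fun h => d (h * u)%g) => [i|h].
  by rewrite mulgKV ed.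
by rewrite de mulgK.
Qed.

Lemma det_isotypic_cong : exists d : int,
  \det (isotypic_mx 1) = (\det abelianized_mx - #|F|%:Z * d)%:~R.
Proof.
have [delta deltaP] :=
  det_fourier_int (fun i j b => al (e i * (e j)^-1)%g (val (e i) * b)).
(* Inversion at [1] weights the block of [y] by [psi (- y)]. The nonzero [y] share one determinant
   and their weights add up to -1, which leaves the difference of the two determinants. *)
exists (delta 1); rewrite rmorphB /= -fourier_inversion.
under eq_bigr => y _ do rewrite -deltaP -/(isotypic_mx y) mul1r.
rewrite (bigD1 0) //= isotypic_mx0 det_map_mx oppr0 (character0 psiP) mulr1.
under eq_bigr => y y0 do rewrite det_isotypic_mx //.
rewrite -mulr_sumr.
have -> : \sum_(y | y != 0) psi (- y) = -1.
  have := sum_characterM psiP (-1).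
  rewrite oppr_eq0 oner_eq0 muln0 (bigD1 0) //= mul0r (character0 psiP) => /eqP.
  rewrite addrC addr_eq0 => /eqP <-.
  by apply: eq_bigr => y _; rewrite mulrN1.
by rewrite mulrN1 opprD addrA subrr add0r opprK.
Qed.

End Isotypic.
End Fourier.

(** * The affine group *)

Section AffineGroup.
Variable F : finFieldType.

Definition aff_mx (h b : F) : 'M[F]_(1 + 1) := block_mx h%:M b%:M 0 1%:M.

Lemma aff_mx_unit (h : {unit F}) (b : F) : aff_mx (val h) b \is a GRing.unit.
Proof.
rewrite -[_ \is a _]/(aff_mx (val h) b \in unitmx) unitmxE det_ublock det1 mulr1.
by rewrite det_scalar1 (valP h).
Qed.

(* aff h b is the map y |-> h y + b. *)
Definition aff (h : {unit F}) (b : F) : {'GL_2[F]} := Sub (aff_mx (val h) b) (aff_mx_unit h b).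

Lemma affM (h k : {unit F}) (b c : F) :
  (aff h b * aff k c)%g = aff (h * k)%g (b + val h * c).
Proof.
apply: val_inj; rewrite /= -[LHS]/(aff_mx _ _ *m aff_mx _ _) /aff_mx mulmx_block.
rewrite !mulmx0 !mul0mx !addr0 add0r -!scalar_mxM !mulr1 -raddfD.
by rewrite [_ + b]addrC.
Qed.

Definition lin_part (g : {'GL_2[F]}) : {unit F} := insubd (1%g : {unit F}) (GLval g ord0 ord0).
Definition trans_part (g : {'GL_2[F]}) : F := GLval g ord0 ord_max.

Lemma affE00 (h b : F) : aff_mx h b ord0 ord0 = h.
Proof.
have -> : ord0 = lshift 1 (ord0 : 'I_1) by apply: val_inj.
by rewrite block_mxEul mxE.
Qed.

Lemma affE01 (h b : F) : aff_mx h b ord0 ord_max = b.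
Proof.
have -> : ord0 = lshift 1 (ord0 : 'I_1) by apply: val_inj.
have -> : ord_max = rshift 1 (ord0 : 'I_1) by apply: val_inj.
by rewrite block_mxEur mxE.
Qed.

Lemma affE10 (h b : F) : aff_mx h b ord_max ord0 = 0.
Proof.
have -> : ord0 = lshift 1 (ord0 : 'I_1) by apply: val_inj.
have -> : ord_max = rshift 1 (ord0 : 'I_1) by apply: val_inj.
by rewrite block_mxEdl mxE.
Qed.

Lemma affE11 (h b : F) : aff_mx h b ord_max ord_max = 1.
Proof.
have -> : ord_max = rshift 1 (ord0 : 'I_1) by apply: val_inj.
by rewrite block_mxEdr mxE.
Qed.

Lemma aff_in_GA1 h b : aff h b \in GA1 F.
Proof. by rewrite inE /= affE10 affE11 !eqxx. Qed.

Lemma lin_part_aff h b : lin_part (aff h b) = h.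
Proof. by rewrite /lin_part /= affE00 /insubd valK. Qed.

Lemma trans_part_aff h b : trans_part (aff h b) = b.
Proof. by rewrite /trans_part /= affE01. Qed.

Lemma aff_parts g : g \in GA1 F -> aff (lin_part g) (trans_part g) = g.
Proof.
rewrite inE => /andP[/eqP g10 /eqP g11].
have g_unit : GLval g ord0 ord0 \is a GRing.unit.
  have := valP g; rewrite -[_ \is a _]/(val g \in unitmx) unitmxE.
  rewrite (expand_det_col _ ord0) big_ord_recl big_ord1.
  have -> : lift ord0 ord0 = ord_max :> 'I_2 by apply: val_inj.
  by rewrite -[val g]/(GLval g) g10 mul0r addr0 !unitfE mulf_eq0 negb_or => /andP[].
apply: val_inj; apply/matrixP => i j /=.
have lp : val (lin_part g) = GLval g ord0 ord0.
  by rewrite /lin_part insubdK.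
have I2 (k : 'I_2) : k = ord0 \/ k = ord_max.
  by case: k => [[|[|k]] lt_k] //; [left | right]; apply: val_inj.
by case: (I2 i) (I2 j) => -> [] ->; rewrite ?affE00 ?affE01 ?affE10 ?affE11.
Qed.

Variables (psi : F -> algC) (n : nat) (e : 'I_n -> {unit F}).
Hypothesis psiP : nontrivial_character psi.
Hypothesis e_bij : bijective e.

Lemma int_group_det_GA1 (a : {'GL_2[F]} -> int) :
  (int_group_det (GA1 F) a)%:~R =
  (\det (abelianized_mx e (fun h b => a (aff h b))))%:~R *
  \det (isotypic_mx psi e (fun h b => a (aff h b)) 1) ^+ #|F|.-1.
Proof.
pose al h b := a (aff h b); have [d ed de] := e_bij.
(* The map [y |-> h (y + b)] gets the coordinates [b] and the index of [h]. A quotient of two such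
   maps then depends on the two [b] only through their difference, as [det_character_blocks]
   requires. *)
pose e2 (k : 'I_#|GA1 F|) : F * 'I_n :=
  ((val (lin_part (enum_val k)))^-1 * trans_part (enum_val k), d (lin_part (enum_val k))).
pose mk (u : F * 'I_n) := aff (e u.2) (val (e u.2) * u.1).
have mkP u : mk u \in GA1 F by apply: aff_in_GA1.
have eunit i : val (e i) != 0 by rewrite -unitfE (valP (e i)).
have mk_e2 k : mk (e2 k) = enum_val k.
  rewrite /mk /e2 /= de mulrA mulrV ?mul1r ?aff_parts ?enum_valP //.
  exact: (valP (lin_part _)).
have e2_bij : bijective e2.
  exists (fun u => enum_rank_in (mkP u) (mk u)) => [k|u].
    by apply: enum_val_inj; rewrite enum_rankK_in // mk_e2.
  case: u => b i; rewrite /e2 enum_rankK_in // lin_part_aff trans_part_aff ed.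
  by rewrite mulrA mulVf ?mul1r.
rewrite -det_map_mx.
have -> : map_mx intr (\matrix_(i < #|GA1 F|, j < #|GA1 F|) a (enum_val i * (enum_val j)^-1)%g)
   = \matrix_(k, l) ((al (e (e2 k).2 * (e (e2 l).2)^-1)%g
       (val (e (e2 k).2) * ((e2 k).1 - (e2 l).1)))%:~R : algC).
  apply/matrixP => k l; rewrite !mxE; congr (a _)%:~R.
  rewrite -!mk_e2; apply: (mulIg (mk (e2 l))); rewrite mulgKV affM mulgKV.
  rewrite /mk; congr (aff _ _).
  by rewrite val_unitM val_unitV mulrBr mulrA mulrVK ?subrK // (valP (e _)).
rewrite (det_character_blocks psiP
  (fun i j b => (al (e i * (e j)^-1)%g (val (e i) * b))%:~R) e2_bij).
rewrite (bigD1 0) //= -/(isotypic_mx psi e al 0) isotypic_mx0 // det_map_mx.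
congr (_ * _); rewrite -(cardC1 (0 : F)) -prodr_const.
apply: eq_big => [y|y y0]; first by rewrite !inE.
exact: det_isotypic_mx.
Qed.
End AffineGroup.

(** * Circulants *)

(** The cyclic shift; the circulants are the polynomials in it. *)
Definition cycmx (R : nzRingType) (n : nat) : 'M[R]_n.+1 :=
  \matrix_(i, j) (i == j.+1 %[mod n.+1])%:R.

Lemma cycmxX (R : nzRingType) (n k : nat) :
  cycmx R n ^+ k = \matrix_(i, j) (i == j + k %[mod n.+1])%:R.
Proof.
elim: k => [|k IHk].
  by rewrite expr0; apply/matrixP => i j; rewrite !mxE addn0 !modn_small.
apply/matrixP => i j; rewrite exprS IHk !mxE.
rewrite (bigD1 (inord ((j + k) %% n.+1))) //= !mxE inordK ?ltn_pmod //.
rewrite modn_mod eqxx mulr1 big1 ?addr0.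
  by rewrite -[(_ %% _).+1]addn1 modnDml addn1 addnS.
move=> l; rewrite !mxE -val_eqE /= inordK ?ltn_pmod // => /negbTE.
by rewrite (modn_small (ltn_ord l)) => ->; rewrite mulr0.
Qed.

Lemma cycmx_order (R : nzRingType) (n : nat) : cycmx R n ^+ n.+1 = 1.
Proof.
rewrite cycmxX; apply/matrixP => i j; rewrite !mxE modnDr.
by rewrite !modn_small.
Qed.

Lemma map_cycmx (R S : nzRingType) (f : {rmorphism R -> S}) n :
  map_mx f (cycmx R n) = cycmx S n.
Proof. by apply/matrixP => i j; rewrite !mxE rmorph_nat. Qed.

Definition circ (n : nat) (p : {poly int}) : int := \det (horner_mx (cycmx int n) p).

Lemma circM n p q : circ n (p * q) = circ n p * circ n q.
Proof. by rewrite /circ rmorphM /= det_mulmx. Qed.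

(** The Vandermonde matrix of the powers of [w] diagonalizes the shift, with eigenvalues
    [w ^+ k]. *)
Lemma circ_root_product n (w : algC) (p : {poly int}) : n.+1.-primitive_root w ->
  (circ n p)%:~R = \prod_(k < n.+1) (map_poly intr p).[w ^+ k] :> algC.
Proof.
move=> prim_w.
pose V : 'M[algC]_n.+1 := \matrix_(k, i) w ^+ (k * i).
pose d : 'rV[algC]_n.+1 := \row_k w ^+ k.
have unitV : V \in unitmx.
  have -> : V = Vandermonde n.+1 d by apply/matrixP => i j; rewrite !mxE exprM exprAC.
  rewrite unitmxE det_Vandermonde unitfE.
  apply/prodf_neq0 => i _; apply/prodf_neq0 => j lt_ij.
  rewrite !mxE subr_eq0 (eq_prim_root_expr prim_w) !modn_small //.
  by rewrite neq_ltn lt_ij orbT.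
have VP : V *m cycmx _ n = diag_mx d *m V.
  apply/matrixP => k j; rewrite mul_diag_mx !mxE -exprD.
  rewrite (bigD1 (inord (j.+1 %% n.+1))) //= big1 ?addr0.
    rewrite !mxE inordK ?ltn_pmod // modn_mod eqxx mulr1.
    rewrite -(prim_expr_mod prim_w) modnMmr (prim_expr_mod prim_w).
    by rewrite mulnS.
  move=> l; rewrite !mxE -val_eqE /= inordK ?ltn_pmod // => /negbTE.
  by rewrite (modn_small (ltn_ord l)) => ->; rewrite mulr0.
rewrite /circ -det_map_mx map_horner_mx map_cycmx.
have -> : cycmx _ n = invmx V *m diag_mx d *m V.
  by rewrite -mulmxA -VP mulmxA mulVmx // mul1mx.
rewrite horner_mx_uconjC // !det_mulmx det_inv mulrAC mulVr ?mul1r //.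
rewrite horner_mx_diag det_diag; apply: eq_bigr => k _.
by rewrite !mxE.
Qed.

(** The left side is the group matrix of a cyclic group; adding [n.+1] keeps the natural subtraction
    from truncating. *)
Lemma circ_poly n (c : nat -> int) :
  \det (\matrix_(i < n.+1, j < n.+1) c ((i + n.+1 - j) %% n.+1)%N) =
  circ n (\poly_(k < n.+1) c k).
Proof.
congr (\det _); apply/matrixP => i j.
rewrite poly_def rmorph_sum /= summxE !mxE.
have lt_ji : (j <= i + n.+1)%N by rewrite ltnW // ltn_addl.
rewrite (bigD1 (inord ((i + n.+1 - j) %% n.+1))) //= big1 ?addr0 /=.
  rewrite linearZ /= rmorphXn /= horner_mx_X cycmxX !mxE.
  rewrite inordK ?ltn_pmod // modnDmr subnKC // modnDr eqxx mulr1 //.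
move=> l; rewrite linearZ /= rmorphXn /= horner_mx_X cycmxX !mxE => l_neq.
case: eqP => [il|]; last by rewrite mulr0.
case/eqP: l_neq; apply: val_inj; rewrite /= inordK ?ltn_pmod //.
apply/eqP; rewrite -[X in X == _](modn_small (ltn_ord l)) -(eqn_modDl j) subnKC //.
by rewrite modnDr il.
Qed.

(** For the shift and the all-ones row this says that every column of the circulant sums to [p.[1]];
    the next lemma does the same for rows. *)
Lemma mul_fixed_row_horner (R : comNzRingType) n (A : 'M[R]_n.+1) (v : 'rV_n.+1) p :
  v *m A = v -> v *m horner_mx A p = p.[1] *: v.
Proof.
move=> vA; elim/poly_ind: p => [|p c IHp]; first by rewrite rmorph0 mulmx0 horner0 scale0r.
rewrite rmorphD rmorphM /= horner_mx_X horner_mx_C mulmxDr mulmxA IHp.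
by rewrite -scalemxAl vA mul_mx_scalar hornerMXaddC mulr1 scalerDl.
Qed.

Lemma mul_fixed_col_horner (R : comNzRingType) n (A : 'M[R]_n.+1) (v : 'cV_n.+1) p :
  A *m v = v -> horner_mx A p *m v = p.[1] *: v.
Proof.
move=> Av; elim/poly_ind: p => [|p c IHp]; first by rewrite rmorph0 mul0mx horner0 scale0r.
rewrite rmorphD rmorphM /= horner_mx_X horner_mx_C mulmxDl -mulmxA Av IHp.
by rewrite mul_scalar_mx hornerMXaddC mulr1 scalerDl.
Qed.

Lemma mul_row1_cycmx (R : nzRingType) n : const_mx 1 *m cycmx R n = const_mx 1 :> 'rV_n.+1.
Proof.
apply/rowP => j; rewrite !mxE (bigD1 (inord (j.+1 %% n.+1))) //= big1 ?addr0.
  by rewrite !mxE inordK ?ltn_pmod // modn_mod eqxx mulr1.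
move=> l; rewrite !mxE -val_eqE /= inordK ?ltn_pmod // => /negbTE.
by rewrite (modn_small (ltn_ord l)) => ->; rewrite mulr0.
Qed.

Lemma mul_cycmx_col1 (R : nzRingType) n : cycmx R n *m const_mx 1 = const_mx 1 :> 'cV_n.+1.
Proof.
apply/colP => i; rewrite !mxE (bigD1 (inord ((i + n) %% n.+1))) //= big1 ?addr0.
  rewrite !mxE inordK ?ltn_pmod // -[(_ %% _).+1]addn1 modnDml addn1 -addnS.
  by rewrite modnDr eqxx mulr1.
move=> l l_neq; rewrite !mxE; case: eqP => [il|]; last by rewrite mul0r.
case/eqP: l_neq; apply: val_inj; rewrite /= inordK ?ltn_pmod //.
rewrite -modnDml il modnDml addSnnS modnDr.
by rewrite modn_small.
Qed.

(* Replace row 0 by the sum of all rows, then column 0 by the sum of all columns: the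
   corner becomes q^2 t and the rest of row 0 and column 0 becomes q t. *)
Lemma det_const_sums_dvd n (C : 'M[int]_(1 + n)) (q t : int) :
  (n.+1%:Z = q) -> const_mx 1 *m C = (q * t) *: const_mx 1 :> 'rV_(1 + n) ->
  C *m const_mx 1 = (q * t) *: const_mx 1 :> 'cV_(1 + n) -> (q ^+ 2 %| \det C)%Z.
Proof.
move=> Dq; pose o : 'rV[int]_n := const_mx 1; pose o' : 'cV[int]_n := const_mx 1.
rewrite -[C](@submxK _ 1 n 1 n); set a := ulsubmx _; set b := ursubmx _.
set c := dlsubmx _; set d := drsubmx _.
have -> : const_mx 1 = row_mx 1%:M o :> 'rV[int]_(1 + n).
  by apply/rowP => j; rewrite !mxE; case: split => k; rewrite !mxE ?ord1.
have -> : const_mx 1 = col_mx 1%:M o' :> 'cV[int]_(1 + n).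
  by apply/colP => j; rewrite !mxE; case: split => k; rewrite !mxE ?ord1.
rewrite mul_row_block mul_block_col !mul1mx !mulmx1 scale_row_mx scale_col_mx.
case/eq_row_mx => ac bd; case/eq_col_mx => ab cd.
have oo' : o *m o' = (q - 1)%:M.
  apply/matrixP => i j; rewrite !mxE !ord1 /=.
  under eq_bigr do rewrite !mxE mulr1.
  by rewrite sumr_const card_ord -Dq -addn1 PoszD addrK natz.
pose U := block_mx 1%:M o 0 1%:M : 'M[int]_(1 + n).
pose W := block_mx 1%:M 0 o' 1%:M : 'M[int]_(1 + n).
pose Q := block_mx q%:M 0 0 1%:M : 'M[int]_(1 + n).
pose X := block_mx t%:M (t *: o) (t *: o') d : 'M[int]_(1 + n).
have UCW : U *m block_mx a b c d *m W = Q *m X *m Q.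
  rewrite !mulmx_block !(mul1mx, mul0mx, mulmx0, mulmx1, add0r, addr0).
  rewrite ac bd cd; congr block_mx.
  - rewrite -scalemxAl oo' -scalerDr -raddfD /= addrC subrK.
    by rewrite scale_scalar_mx !scalar_mxM.
  - by rewrite mul_scalar_mx scalerA.
  - by rewrite mul_mx_scalar scalerA.
have : \det (U *m block_mx a b c d *m W) = \det (Q *m X *m Q) by rewrite UCW.
rewrite !det_mulmx det_ublock det_lblock det_ublock !det1 !mulr1 mul1r det_scalar1.
by move->; rewrite mulrC mulrA -expr2 dvdz_mulr.
Qed.

Section PrimeCirculant.
Variables (n : nat).
Hypothesis pr_n : prime n.+1.

Lemma pchar_n : n.+1 \in [pchar 'F_n.+1]. Proof. exact: pchar_Fp. Qed.

(* X^q - 1 = (X - 1)^q in F_q[X]; if p(1) <> 0 then p is prime to it, and Bezout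
   inverts the circulant modulo q. *)
Lemma dvd_circ_prime (p : {poly int}) : (n.+1%:Z %| circ n p)%Z -> (n.+1%:Z %| p.[1])%Z.
Proof.
rewrite !(dvdz_pcharf pchar_n); apply: contraTT => p1.
rewrite /circ -det_map_mx map_horner_mx map_cycmx /=.
set pb := map_poly _ p.
have : coprimep pb ('X ^+ n.+1 - 1).
  have -> : 'X ^+ n.+1 - 1 = ('X - 1%:P) ^+ n.+1 :> {poly 'F_n.+1}.
    have chP : n.+1 \in [pchar {poly 'F_n.+1}] by rewrite pchar_poly pchar_n.
    have := pFrobenius_autB_comm chP (mulrC 'X 1%:P).
    by rewrite !pFrobenius_autE => ->; rewrite -polyC_exp expr1n.
  apply: coprimep_expr; rewrite coprimep_XsubC.
  by rewrite rootE -(rmorph1 intr) horner_map.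
case/Bezout_eq1_coprimepP => -[u v] /= uv.
have : horner_mx (cycmx 'F_n.+1 n) (u * pb + v * ('X ^+ n.+1 - 1)) = 1.
  by rewrite uv rmorph1.
rewrite rmorphD !rmorphM /= rmorphB /= rmorphXn rmorph1 /= horner_mx_X cycmx_order.
rewrite subrr mulr0 addr0 => /(congr1 determinant); rewrite det_mulmx det1.
by move=> /eqP; apply: contraTneq => ->; rewrite mulr0 eq_sym oner_eq0.
Qed.

Lemma dvd_circ_prime_sqr (p : {poly int}) :
  (n.+1%:Z %| circ n p)%Z -> (n.+1%:Z ^+ 2 %| circ n p)%Z.
Proof.
move/dvd_circ_prime/dvdzP => [t Dp1].
apply: (@det_const_sums_dvd _ _ _ t) => //.
  by rewrite (mul_fixed_row_horner _ (mul_row1_cycmx _ _)) Dp1 mulrC.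
by rewrite (mul_fixed_col_horner _ (mul_cycmx_col1 _ _)) Dp1 mulrC.
Qed.

End PrimeCirculant.

Lemma circ_mod2 n (p q : {poly int}) :
  map_poly intr p = map_poly intr q :> {poly 'F_2} -> (2 %| circ n p)%Z = (2 %| circ n q)%Z.
Proof.
move=> pq; rewrite !(dvdz_pcharf (pchar_Fp (isT : prime 2))) /circ.
by rewrite -!det_map_mx !map_horner_mx pq.
Qed.

(** The numbers [2 * j] are the even residues modulo 26, and adding 13 gives the odd ones. *)
Lemma big_even_odd26 (h : nat -> algC) :
  \prod_(k < 26) h k = (\prod_(j < 13) h (2 * j)%N) * \prod_(j < 13) h ((2 * j + 13) %% 26)%N.
Proof.
have E (g : nat -> nat) m : \prod_(j < m) h (g j) = \prod_(k <- map g (iota 0 m)) h k.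
  by rewrite big_map -(big_mkord predT (fun j => h (g j))) /index_iota subn0.
rewrite (E id) (E (muln 2)) (E (fun j => (2 * j + 13) %% 26)%N) -big_cat map_id.
exact: perm_big.
Qed.

(** Even exponents run through the 13th roots of unity. Since [w ^+ 13 = -1], odd exponents run
    through their negatives, where [p] takes the values of [p \Po - 'X]. *)
Lemma circ26_split (p : {poly int}) :
  circ 25 p = circ 12 p * circ 12 (p \Po - 'X).
Proof.
have [w prim_w] := C_prim_root_exists (isT : (0 < 26)%N).
have prim_w2 : 13.-primitive_root (w ^+ 2) by exact: (dvdn_prim_root prim_w (isT : (13 %| 26)%N)).
have w13 : w ^+ 13 = -1.
  have /eqP : (w ^+ 13) ^+ 2 = 1 by rewrite -exprM (prim_expr_order prim_w).
  rewrite sqrf_eq1 => /orP[|/eqP//].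
  by rewrite -(prim_order_dvd prim_w).
apply: (intr_inj (R := algC)); rewrite rmorphM /=.
rewrite (circ_root_product _ prim_w) !(circ_root_product _ prim_w2).
rewrite (big_even_odd26 (fun k => (map_poly intr p).[w ^+ k])).
congr (_ * _); apply: eq_bigr => j _; first by rewrite exprM.
rewrite map_comp_poly rmorphN /= map_polyX horner_comp hornerN hornerX.
by rewrite (prim_expr_mod prim_w) exprD w13 mulrN1 exprM.
Qed.

Lemma circ26_dvd (p : {poly int}) :
  ((2 %| circ 25 p)%Z -> (4 %| circ 25 p)%Z) /\
  ((13 %| circ 25 p)%Z -> (13 ^+ 2 %| circ 25 p)%Z).
Proof.
split; rewrite circ26_split.
  (* Modulo 2 the substitution of [- 'X] is the identity, so the two factors have the same
     parity. *)
  have E : (2 %| circ 12 (p \Po - 'X))%Z = (2 %| circ 12 p)%Z.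
    apply: circ_mod2; rewrite map_comp_poly rmorphN /= map_polyX.
    have -> : - 'X = 'X :> {poly 'F_2}; last by rewrite comp_polyXr.
    apply/polyP => i; rewrite coefN.
    by apply/eqP; rewrite eq_sym -addr_eq0; case: ('X`_i) => [[|[|]]].
  rewrite !(dvdz_pcharf (pchar_Fp (isT : prime 2))) rmorphM mulf_eq0 in E *.
  rewrite E orbb -(dvdz_pcharf (pchar_Fp (isT : prime 2))) => dvd2.
  by rewrite -[4]/(2 * 2)%:Z PoszM dvdz_mul // (dvdz_pcharf (pchar_Fp (isT : prime 2))) E
             -(dvdz_pcharf (pchar_Fp (isT : prime 2))).
rewrite -circM; exact: (@dvd_circ_prime_sqr 12).
Qed.

(** * Lifting matrices modulo N with prescribed determinant *)

Section LiftDet.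
Variables (R : comNzRingType) (N : int).
Hypothesis N0 : N%:~R = 0 :> R.
Local Notation "A ^R" := (map_mx (intr : int -> R) A) (at level 2).

(* diag(a, 1/a) lifts to [[a, -v N], [N, u]] where u a + v N^2 = 1. *)
Lemma lift_diag2 (a : int) : coprimez a N ->
  exists S : 'M[int]_2, exists2 a' : int, a%:~R * a'%:~R = 1 :> R &
    \det S = 1 /\ S^R = diag_mx (\row_j if j == 0 then a%:~R else a'%:~R).
Proof.
move=> coaN; have : coprimez a (N * N) by rewrite coprimezMr coaN.
case/coprimezP => -[u v] /= uv.
exists (\matrix_(i, j) if i == 0 then (if j == 0 then a else - (v * N))
  else (if j == 0 then N else u)); exists u.
  have := congr1 (intr : int -> R) uv.
  by rewrite rmorphD !rmorphM /= N0 !mulr0 addr0 mulrC => ->.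
split.
  rewrite (expand_det_row _ ord0) !big_ord_recl big_ord0 /cofactor !det_mx11 !mxE /=.
  by rewrite !expr0 !mul1r addr0 expr1 mulN1r mulrNN -mulrA -uv mulrC.
apply/matrixP => i j; rewrite !mxE.
have I2 (k : 'I_2) : k = 0 \/ k = 1.
  by case: k => [[|[|k]] lt_k] //; [left | right]; apply: val_inj.
by case: (I2 i) (I2 j) => -> [] -> /=; rewrite ?rmorphN ?rmorphM /= ?N0 ?mulr0 ?oppr0.
Qed.

(** Split off diag(a, 1/a, 1, ..., 1), with a the first entry, which lifts with determinant 1. What
    remains has first entry 1 and the product of the first two entries next, so the size drops by
    one; a 1 x 1 matrix lifts to [B] itself. *)
Lemma lift_diag n (d : 'rV[int]_n.+1) (B : int) : (forall j, coprimez (d 0 j) N) ->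
  B%:~R = \prod_j (d 0 j)%:~R :> R ->
  exists2 Y : 'M[int]_n.+1, Y^R = (diag_mx d)^R & \det Y = B.
Proof.
elim: n d B => [|n IHn] d B cod DB.
  exists B%:M; last by rewrite det_scalar1.
  by apply/matrixP => i j; rewrite !mxE !ord1 eqxx !mulr1n DB big_ord1.
have [S [a' aa' [detS DS]]] := lift_diag2 (cod ord0).
pose d' : 'rV[int]_n.+1 :=
  \row_j if j == 0 then d 0 ord0 * d 0 (lift ord0 ord0) else d 0 (lift ord0 j).
have [||Y' DY' detY'] := IHn d' B.
- move=> j; rewrite mxE; case: ifP => _; last exact: cod.
  by rewrite coprimezMl !cod.
- rewrite DB !big_ord_recl mxE eqxx rmorphM -mulrA; congr (_ * (_ * _)).
  by apply: eq_bigr => j _; rewrite mxE.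
exists ((block_mx S 0 0 1%:M : 'M_(1 + 1 + n)) *m (block_mx 1%:M 0 0 Y' : 'M_(1 + n.+1))).
  have diag1 m : 1%:M = diag_mx (const_mx 1) :> 'M[R]_m.
    by apply/matrixP => i j; rewrite !mxE.
  pose e1 : 'rV[R]_(2 + n) :=
    row_mx (\row_j if j == 0 then (d 0 ord0)%:~R else a'%:~R) (const_mx 1).
  pose e2 : 'rV[R]_(1 + n.+1) := row_mx (const_mx 1) (map_mx intr d').
  have D1 : (block_mx S 0 0 1%:M : 'M_(2 + n))^R = diag_mx e1.
    by rewrite map_block_mx DS !raddf0 map_mx1 diag1 -diag_mx_row.
  have D2 : (block_mx 1%:M 0 0 Y' : 'M_(1 + n.+1))^R = diag_mx e2.
    by rewrite map_block_mx DY' !raddf0 map_mx1 diag1 map_diag_mx -diag_mx_row.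
  rewrite map_mxM; transitivity (diag_mx e1 *m diag_mx e2); first exact: (congr2 mulmx D1 D2).
  rewrite mulmx_diag map_diag_mx; congr diag_mx; apply/rowP => j; rewrite !mxE.
  case: splitP => j1 /= Dj1; rewrite !mxE; case: splitP => j2 /= Dj2; rewrite !mxE.
  - have j2_0 : j2 = 0 :> nat by case: j2 {Dj2} => [[]].
    have -> : j1 = 0 by apply: val_inj; rewrite /= -Dj1 Dj2.
    have -> : j = ord0 by apply: val_inj; rewrite /= Dj2 j2_0.
    by rewrite eqxx mulr1.
  - have j1_1 : j1 = 1 :> nat by case: j1 Dj1 => [[|[|]]] //=; rewrite Dj2.
    have -> : j1 = 1 by apply: val_inj.
    have -> : j2 = 0 by apply: val_inj; move: Dj2; rewrite Dj1 j1_1 => -[].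
    have -> : j = lift ord0 ord0 by apply: val_inj; rewrite /= Dj1.
    by rewrite rmorphM mulrA [a'%:~R * _]mulrC aa' mul1r.
  - by have := ltn_ord j2; rewrite -Dj2 Dj1.
  - have j2_neq0 : j2 != 0 by rewrite -val_eqE /= -(eqn_add2l 1) -Dj2 Dj1.
    have -> : j = lift ord0 j2 by apply: val_inj; rewrite /= Dj2.
    by rewrite (negbTE j2_neq0) mul1r.
transitivity (\det (block_mx S 0 0 (1%:M : 'M_n)) * \det (block_mx (1%:M : 'M_1) 0 0 Y')).
  exact: det_mulmx.
by rewrite !det_ublock !det1 detS !mul1r.
Qed.

(** The Smith normal form reduces this to [lift_diag]; the outer factors have determinant 1 or -1,
    which the target [\det L * B * \det Q] compensates. *)
Lemma lift_det n (X : 'M[int]_n.+1) (B : int) : coprimez (\det X) N ->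
  B%:~R = (\det X)%:~R :> R -> exists2 Y : 'M[int]_n.+1, Y^R = X^R & \det Y = B.
Proof.
have [L unitL [Q unitQ [s _ ->]]] := int_Smith_normal_form X.
set D := \matrix_(i, j) _.
have {D}-> : D = diag_mx (\row_(j < n.+1) s`_j).
  by apply/matrixP => i j; rewrite !mxE -val_eqE.
set d := \row_j _; rewrite !det_mulmx det_diag => coX DB.
have sqr1 (A : 'M[int]_n.+1) : A \in unitmx -> \det A * \det A = 1.
  by rewrite unitmxE => /orP[] /eqP ->.
have [||Y DY detY] := @lift_diag n d (\det L * B * \det Q).
- move=> j; move: coX; rewrite (bigD1 j) //= !coprimezMl.
  by case/andP => /andP[_ /andP[]].
- transitivity ((\det L * \det L)%:~R * (\det Q * \det Q)%:~R *
      \prod_(j < n.+1) (d 0 j)%:~R : R); last by rewrite !sqr1 // !mul1r.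
  by rewrite !rmorphM /= DB !rmorphM /= rmorph_prod; ring.
exists (L *m Y *m Q); first by rewrite !map_mxM DY.
rewrite !det_mulmx detY.
transitivity ((\det L * \det L) * (\det Q * \det Q) * B); first by ring.
by rewrite !sqr1 // !mul1r.
Qed.
End LiftDet.

(** * Circulants of prescribed determinant *)

Definition geom (R : nzRingType) (r : nat) : {poly R} := \sum_(i < r) 'X^i.

Lemma geomM (R : comNzRingType) r : ('X - 1) * geom R r = 'X^r - 1.
Proof. by rewrite -subrX1. Qed.

Lemma geom1 (R : comNzRingType) r : (geom R r).[1] = r%:R.
Proof.
rewrite /geom horner_sum; under eq_bigr do rewrite hornerXn expr1n.
by rewrite sumr_const card_ord.
Qed.

Lemma map_geom r : map_poly intr (geom int r) = geom algC r.
Proof. by rewrite rmorph_sum; apply: eq_bigr => i _; rewrite /= map_polyXn. Qed.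

Section RootProducts.
Variables (n : nat) (w : algC).
Hypothesis prim_w : n.+1.-primitive_root w.

Definition nontrivial_prod (p : {poly int}) : algC :=
  \prod_(k < n.+1 | k != 0) (map_poly intr p).[w ^+ k].

Lemma circ_nontrivial_prod p : (circ n p)%:~R = p.[1]%:~R * nontrivial_prod p.
Proof.
rewrite (circ_root_product _ prim_w) (bigD1 0) //= expr0.
by rewrite -horner_map /= rmorph1.
Qed.

Lemma prim_root_neq1 (k : 'I_n.+1) : k != 0 -> w ^+ k != 1.
Proof.
by apply: contra => /eqP wk; rewrite -val_eqE /= -(modn_small (ltn_ord k))
  -/(dvdn _ _) (prim_order_dvd prim_w) wk.
Qed.

Lemma horner_geom_root (k : 'I_n.+1) : k != 0 -> (geom algC n.+1).[w ^+ k] = 0.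
Proof.
move=> /prim_root_neq1 wk_neq1; apply/eqP.
have /(congr1 (horner^~ (w ^+ k))) := geomM algC n.+1.
rewrite hornerM !hornerE -exprM mulnC exprM (prim_expr_order prim_w) expr1n subrr.
by move=> /eqP; rewrite mulf_eq0 subr_eq0 (negbTE wk_neq1).
Qed.

Lemma eq_nontrivial_prod p q :
  (forall k : 'I_n.+1, k != 0 -> (map_poly intr p).[w ^+ k] = (map_poly intr q).[w ^+ k]) ->
  nontrivial_prod p = nontrivial_prod q.
Proof. by move=> pq; apply: eq_bigr. Qed.

Lemma circ_add_geom p (m : int) :
  (circ n (p + m%:P * geom int n.+1))%:~R = (p.[1] + n.+1%:Z * m)%:~R * nontrivial_prod p.
Proof.
rewrite circ_nontrivial_prod; congr (_ %:~R * _).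
  by rewrite !hornerE geom1 natz mulrC.
apply: eq_nontrivial_prod => k k_neq0.
by rewrite rmorphD rmorphM /= map_geom hornerD hornerM horner_geom_root // mulr0 addr0.
Qed.

Lemma nontrivial_prodM p q :
  nontrivial_prod (p * q) = nontrivial_prod p * nontrivial_prod q.
Proof.
rewrite -big_split; apply: eq_bigr => k _.
by rewrite rmorphM /= hornerM.
Qed.

(** Cancel ['X - 1] in the factorization of ['X^n.+1 - 1] and evaluate at 1. *)
Lemma nontrivial_prod_1subX : nontrivial_prod (1 - 'X) = n.+1%:R.
Proof.
have := factor_Xn_sub_1 prim_w; rewrite big_mkord (bigD1 ord0) //= expr0 -geomM.
move=> /mulfI; rewrite polyXsubC_eq0 => /(_ isT) /(congr1 (horner^~ 1)).
rewrite geom1 horner_prod => <-; apply: eq_bigr => k _.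
by rewrite rmorphB rmorph1 /= map_polyX !hornerE.
Qed.

(** Evaluate the factorization of ['X^n.+1 - 1] at -1. *)
Lemma circ_1addX : odd n.+1 -> circ n (1 + 'X) = 2.
Proof.
move=> odd_n; apply: (intr_inj (R := algC)); rewrite (circ_root_product _ prim_w).
have := factor_Xn_sub_1 prim_w; rewrite big_mkord => /(congr1 (horner^~ (-1))).
rewrite horner_prod !hornerE -signr_odd odd_n expr1 => E.
have -> : \prod_(k < n.+1) (map_poly intr (1 + 'X)).[w ^+ k] =
    (-1) ^+ n.+1 * \prod_(k < n.+1) ('X - (w ^+ k)%:P).[-1].
  rewrite -[in X in X * _](card_ord n.+1) -prodrN; apply: eq_bigr => k _.
  by rewrite rmorphD rmorph1 /= map_polyX !hornerE opprB opprK addrC.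
by rewrite E -signr_odd odd_n expr1 mulN1r opprD opprK.
Qed.

End RootProducts.

(** Multiplied by ['X - 1], the polynomial becomes ['X^r - 1], whose values at the powers of [w] are
    those of ['X - 1] at the powers of the primitive root [w ^+ r]. *)
Lemma nontrivial_prod_geom n w r : n.+1.-primitive_root w -> coprime r n.+1 ->
  nontrivial_prod n w (geom int r) = 1.
Proof.
move=> prim_w co_r.
have prim_wr : n.+1.-primitive_root (w ^+ r) by rewrite prim_root_exp_coprime.
have X1_neq0 : nontrivial_prod n w ('X - 1) != 0.
  apply/prodf_neq0 => k k_neq0; rewrite rmorphB rmorph1 /= map_polyX !hornerE.
  by rewrite subr_eq0 prim_root_neq1.
apply: (mulfI X1_neq0); rewrite -nontrivial_prodM geomM mulr1.
transitivity (nontrivial_prod n (w ^+ r) ('X - 1)).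
  apply: eq_bigr => k _; rewrite !rmorphB !rmorph1 /= map_polyXn map_polyX !hornerE.
  by rewrite -!exprM mulnC.
(* The product for ['X - 1] does not depend on the primitive root: up to the factor [n.+1] it is an
   integer circulant determinant. The added [geom] makes the value at 1 nonzero. *)
have E v : n.+1.-primitive_root v -> (circ n ('X - 1 + 1%:P * geom int n.+1))%:~R =
    n.+1%:R * nontrivial_prod n v ('X - 1).
  by move=> prim_v; rewrite (circ_add_geom prim_v) !hornerE.
apply: (mulfI (_ : n.+1%:R != 0)); first by rewrite pnatr_eq0.
by rewrite -(E _ prim_wr) (E _ prim_w).
Qed.

Lemma circ12_1addX2 : circ 12 (1 + 'X^2) = 2.
Proof.
have [z prim_z] := C_prim_root_exists (isT : (0 < 13)%N).
have prim_z2 : 13.-primitive_root (z ^+ 2) by rewrite prim_root_exp_coprime.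
rewrite -(circ_1addX prim_z) //; apply: (intr_inj (R := algC)).
rewrite (circ_root_product _ prim_z) (circ_root_product _ prim_z2).
apply: eq_bigr => k _; rewrite !rmorphD !rmorph1 /= map_polyXn map_polyX !hornerE.
by rewrite -!exprM mulnC.
Qed.

(* Adding m (1 + X + ... + X^25) only changes the value at the trivial root, so K is the
   product of the values of u at the 25 nontrivial roots. *)
Definition circ_slope (u : {poly int}) (K : int) :=
  forall m, circ 25 (u + m%:P * geom int 26) = (u.[1] + 26 * m) * K.

Lemma circ_slopeP u K w : 26.-primitive_root w -> nontrivial_prod 25 w u = K%:~R ->
  circ_slope u K.
Proof.
move=> prim_w DK m; apply: (intr_inj (R := algC)).
by rewrite (circ_add_geom prim_w) rmorphM /= DK.
Qed.

Lemma circ_slope_1subX : circ_slope (1 - 'X) 26.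
Proof.
have [w prim_w] := C_prim_root_exists (isT : (0 < 26)%N).
by apply: (circ_slopeP prim_w); rewrite (nontrivial_prod_1subX prim_w).
Qed.

Lemma circ_slope_geom r : coprime r 26 -> circ_slope (geom int r) 1.
Proof.
have [w prim_w] := C_prim_root_exists (isT : (0 < 26)%N).
by move=> co_r; apply: (circ_slopeP prim_w); rewrite nontrivial_prod_geom.
Qed.

Lemma circ_slope_1addX2 r : coprime r 26 -> circ_slope ((1 + 'X^2) * geom int r) 2.
Proof.
have [w prim_w] := C_prim_root_exists (isT : (0 < 26)%N).
move=> co_r; apply: (circ_slopeP prim_w).
rewrite nontrivial_prodM nontrivial_prod_geom // mulr1.
(* This circulant of size 26 is 2 * 2 = 4 and the value at 1 is 2, so the nontrivial roots
   contribute 2. *)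
have := circ_nontrivial_prod prim_w (1 + 'X^2).
rewrite circ26_split rmorphD rmorphXn rmorph1 /= comp_polyX sqrrN circ12_1addX2 !hornerE expr1n.
move=> E; apply: (mulfI (_ : 2%:~R != 0)); first by rewrite intr_eq0.
by rewrite -rmorphM; exact: esym E.
Qed.

Lemma circ_slope_13 : circ_slope (geom int 14 - 'X) 13.
Proof.
have [w prim_w] := C_prim_root_exists (isT : (0 < 26)%N).
have [z prim_z] := C_prim_root_exists (isT : (0 < 13)%N).
apply: (circ_slopeP prim_w).
have f1 : (geom int 14 - 'X).[1] = 13 by rewrite hornerD geom1 !hornerE.
(* At a nontrivial 13th root of unity the first 13 terms of [geom] cancel and ['X^13] becomes 1,
   leaving [1 - 'X]. *)
have E1 : circ 12 (geom int 14 - 'X) = 169.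
  apply: (intr_inj (R := algC)); rewrite (circ_nontrivial_prod prim_z) f1.
  rewrite (@eq_nontrivial_prod _ _ _ (1 - 'X)) ?(nontrivial_prod_1subX prim_z).
    by rewrite -[RHS]/((13 * 13)%:~R) rmorphM.
  move=> k k_neq0; rewrite !rmorphB /= map_geom rmorph1 map_polyX.
  rewrite /geom big_ord_recr /= -/(geom algC 13) !hornerE.
  rewrite (horner_geom_root prim_z) // add0r -exprM mulnC exprM.
  by rewrite (prim_expr_order prim_z) expr1n.
(* Multiplied by [1 + 'X], the polynomial agrees with [1 + 'X^2] at all 13th roots of unity, and
   both of these have circulant determinant 2. *)
have E2 : circ 12 ((geom int 14 - 'X) \Po - 'X) = 1.
  set f' := _ \Po _.
  have f'M : f' * (1 + 'X) = 1 + 'X^2 + 'X - 'X^14.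
    have /(congr1 (comp_poly (- 'X))) := geomM int 14.
    rewrite rmorphM !rmorphB rmorphXn !rmorph1 /= comp_polyX.
    rewrite /f' rmorphB /= comp_polyX; set g := _ \Po _ => Dg.
    have -> : (g - - 'X) * (1 + 'X) = 'X + 'X * 'X - (- 'X - 1) * g by ring.
    by rewrite Dg; ring.
  have : circ 12 (f' * (1 + 'X)) = circ 12 (1 + 'X^2).
    apply: (intr_inj (R := algC)); rewrite !(circ_root_product _ prim_z).
    apply: eq_bigr => k _; rewrite f'M rmorphB !rmorphD !rmorph1 /= !map_polyXn map_polyX.
    rewrite !hornerE (exprS _ 13) -[_ ^+ k ^+ 13]exprM mulnC exprM.
    by rewrite (prim_expr_order prim_z) expr1n mulr1 addrK.
  rewrite circM circ12_1addX2 (circ_1addX prim_z) // => E.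
  by apply: (mulIf (_ : 2 != 0 :> int)) => //; rewrite E.
have := circ_nontrivial_prod prim_w (geom int 14 - 'X).
rewrite circ26_split E1 E2 f1.
move=> E; apply: (mulfI (_ : 13%:~R != 0)); first by rewrite intr_eq0.
by rewrite -rmorphM; exact: esym E.
Qed.

(* According to whether 13 or 2 divides A, the polynomial u is 1 - X (with K = 26),
   1 + X^2 + X^3 + ... + X^13 (K = 13), (1 + X^2)(1 + ... + X^(r-1)) (K = 2) or
   1 + ... + X^(r-1) (K = 1). *)
Lemma exists_circ_slope (A : int) :
  ((2 %| A)%Z -> (4 %| A)%Z) -> ((13 %| A)%Z -> (13 ^+ 2 %| A)%Z) ->
  exists u m K, [/\ circ_slope u K, coprimez K 27 & A = (u.[1] + 26 * m) * K].
Proof.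
move=> A2 A13.
have [d13|nd13] := boolP (13 %| A)%Z; have [d2|nd2] := boolP (2 %| A)%Z.
(* The multiplier [m] solves [A = 26 m * 26] here and [A = (13 + 26 m) * 13] in the next case, where
   [A] is an odd multiple of 169. *)
- exists (1 - 'X), (A %/ 676)%Z, 26; split=> //; first exact: circ_slope_1subX.
  have {}d13 := A13 d13; have {}d2 := A2 d2; rewrite !hornerE.
  lia.
- exists (geom int 14 - 'X), ((A %/ 169)%Z %/ 2)%Z, 13; split=> //; first exact: circ_slope_13.
  have {}d13 := A13 d13; rewrite hornerD geom1 !hornerE.
  lia.
- have {}d2 := A2 d2.
  (* [r] is the odd residue modulo 26 congruent to [A / 4] modulo 13, hence coprime to 26, and the
     equation becomes [A = 4 (r + 13 m)]. *)
  pose i := (A %/ 4)%Z; pose i13 := `|(i %% 13)%Z|%N; pose r := (i13 + 13 * ~~ odd i13)%N.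
  have co_r : coprime r 26.
    rewrite coprime_sym -[26%N]/(2 * 13)%N coprimeMl !prime_coprime // /r /i13 /i.
    lia.
  exists ((1 + 'X^2) * geom int r), ((i - r%:Z) %/ 13)%Z, 2; split=> //.
    exact: circ_slope_1addX2.
  rewrite hornerM geom1 !hornerE expr1n.
  rewrite /r /i13 /i; lia.
- pose r := `|(A %% 26)%Z|%N.
  have co_r : coprime r 26.
    rewrite coprime_sym -[26%N]/(2 * 13)%N coprimeMl !prime_coprime // /r.
    lia.
  exists (geom int r), (A %/ 26)%Z, 1; split=> //; first exact: circ_slope_geom.
  by rewrite geom1 natz /r; lia.
Qed.

(** * Rank-one perturbations and lifts of circulants modulo 27 *)

(** The products of [W] and [V] in the two orders are both block triangular; comparing their
    determinants gives the formula. *)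
Lemma det_1add_rank1 (R : comNzRingType) n (c : 'cV[R]_n) (l : 'rV_n) :
  \det (1%:M + c *m l) = 1 + (l *m c) 0 0.
Proof.
pose W := block_mx 1%:M (- l) c 1%:M : 'M_(1 + n).
pose V := block_mx 1%:M l 0 1%:M : 'M_(1 + n).
have detV : \det V = 1 by rewrite det_ublock !det1 mulr1.
have WV : W *m V = block_mx 1%:M 0 c (1%:M + c *m l).
  rewrite mulmx_block !(mul1mx, mulmx1, mulmx0, mul0mx, addr0, add0r) subrr.
  by rewrite [c *m l + _]addrC.
have VW : V *m W = block_mx (1%:M + l *m c) 0 c 1%:M.
  by rewrite mulmx_block !(mul1mx, mulmx1, mulmx0, mul0mx, addr0, add0r) addNr.
have := congr1 determinant WV; rewrite det_mulmx detV mulr1 det_lblock det1 mul1r => <-.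
have := congr1 determinant VW; rewrite det_mulmx detV mul1r det_lblock det1 mulr1 => ->.
by rewrite det_mx11 !mxE.
Qed.

Lemma horner_cycmx_geom (R : comNzRingType) n :
  horner_mx (cycmx R n) (geom R n.+1) = const_mx 1.
Proof.
apply/matrixP => i j; rewrite rmorph_sum summxE /=.
have lt_ji : (j <= i + n.+1)%N by rewrite ltnW // ltn_addl.
rewrite mxE (bigD1 (inord ((i + n.+1 - j) %% n.+1))) //= big1 ?addr0 /=.
  rewrite rmorphXn /= horner_mx_X cycmxX !mxE.
  by rewrite inordK ?ltn_pmod // modnDmr subnKC // modnDr eqxx.
move=> l; rewrite rmorphXn /= horner_mx_X cycmxX !mxE => l_neq.
case: eqP => [il|//]; case/eqP: l_neq; apply: val_inj; rewrite /= inordK ?ltn_pmod //.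
apply/eqP; rewrite -[X in X == _](modn_small (ltn_ord l)) -(eqn_modDl j) subnKC //.
by rewrite modnDr il.
Qed.

Lemma dvdz_intr_Zp (N : nat) (x : int) : (1 < N)%N -> x%:~R = 0 :> 'Z_N -> (N %| x)%Z.
Proof.
move=> N_gt1; have N_gt0 : (0 < N)%N by apply: ltnW.
have N_neq0 : N%:Z != 0 by rewrite -lt0n.
have := divz_eq x N; have := modz_ge0 x N_neq0; have := ltz_pmod x (N_gt0 : 0 < N%:Z).
case: (x %% N)%Z => // r lt_r _ -> /=.
rewrite rmorphD rmorphM /= -[N%:~R]/(N%:R) pchar_Zp // mulr0 add0r.
move=> /(congr1 val); rewrite /= val_Zp_nat // modn_small // => ->.
by rewrite addr0 dvdz_mull.
Qed.

Lemma mul_row1_col1 (R : nzRingType) n :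
  const_mx 1 *m (const_mx 1 : 'cV_n) = n%:R%:M :> 'M[R]_1.
Proof.
apply/matrixP => i j; rewrite !ord1 !mxE; under eq_bigr do rewrite !mxE mulr1.
by rewrite sumr_const card_ord.
Qed.

Lemma lift_circ_slope (u : {poly int}) (m K B : int) : circ_slope u K -> coprimez K 27 ->
  (B = (u.[1] + 26 * m) * K %[mod 27])%Z ->
  exists n : 'M[int]_26,
    \det (horner_mx (cycmx int 25) (u + m%:P * geom int 26) + 27%:Z *: n) = B.
Proof.
move=> uK /coprimezP[[e f] /= eK] BE.
(* As 26 is -1 modulo 27, this [m0] makes the row sum [s0] congruent to [e], the inverse of [K], so
   that [C m0] has determinant 1 modulo 27. *)
pose s := u.[1]; pose m0 := s - e; pose s0 := s + 26 * m0.
pose C m := horner_mx (cycmx int 25) (u + m%:P * geom int 26).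
have CE m' : C m' = horner_mx (cycmx int 25) u + m' *: const_mx 1.
  rewrite /C rmorphD rmorphM /= horner_mx_C horner_cycmx_geom.
  by congr (_ + _); rewrite -mul_scalar_mx.
pose q := s * K - 1 + 26 * f.
have s0K : s0 * K = 1 + 27 * q.
  have eK' : e * K = 1 - f * 27 by rewrite -[LHS](addrK (f * 27)) eK.
  transitivity (27 * (s * K) - 26 * (e * K)); first by rewrite /s0 /m0; ring.
  by rewrite eK' /q; ring.
have R0 : 27%:~R = 0 :> 'Z_27 by apply: val_inj.
have s0K1 : (s0 * K)%:~R = 1 :> 'Z_27.
  by rewrite s0K rmorphD (rmorphM _ 27) /= R0 mul0r addr0.
have detC0 : \det (C m0) = s0 * K by apply: uK.
have [||Y DY detY] := @lift_det 'Z_27 27 R0 25 (C m0) 1.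
- rewrite detC0; apply/coprimezP; exists (1, - q).
  by rewrite /= s0K; ring.
- by rewrite detC0 s0K1.
(* [C m] differs from [C m0] by [m - m0] times the all-ones matrix J. As [C m0] multiplies J by
   [s0], the inverse of [K], this [z] gives [C m = C m0 (1 + z J)] modulo 27. *)
pose z := K * (m - m0).
have [k Dk] : exists k, B = 1 + 26 * z + 27 * k.
  have : (27 %| B - (1 + 26 * z))%Z.
    move/eqP: BE; rewrite eqz_mod_dvd => BE.
    have -> : B - (1 + 26 * z) = (B - (s + 26 * m) * K) + 27 * q.
      rewrite -[27 * q](addKr 1) -s0K /z /s0 /m0; ring.
    by apply: rpredD; [exact: BE | exact/dvdz_mulr/dvdzz].
  by case/dvdzP => k Dk; exists k; rewrite [27 * k]mulrC -Dk addrC subrK.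
(* The term [27 * k] is invisible modulo 27 and moves the determinant [1 + 26 * z] to [B]. *)
pose l : 'rV[int]_26 := z *: const_mx 1 + (27 * k) *: delta_mx 0 0.
pose M := Y *m (1%:M + const_mx 1 *m l).
have lc : l *m const_mx 1 = (26 * z + 27 * k)%:M.
  rewrite mulmxDl -!scalemxAl -rowE row_const mul_row1_col1 [const_mx 1]mx11_scalar.
  by rewrite [const_mx 1 0 0]mxE !scale_scalar_mx -raddfD mulr1 [z * _]mulrC.
have detM : \det M = B.
  by rewrite det_mulmx detY mul1r det_1add_rank1 lc [_%:M 0 0]mxE Dk addrA.
have fixC0 : C m0 *m const_mx 1 = s0 *: const_mx 1 :> 'cV[int]_26.
  rewrite (mul_fixed_col_horner _ (mul_cycmx_col1 _ _)) !hornerE geom1.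
  by rewrite [m0 * _]mulrC.
have MC : map_mx intr M = map_mx intr (C m) :> 'M['Z_27]_26.
  have J : (const_mx 1 : 'cV_26) *m const_mx 1 = const_mx 1 :> 'M['Z_27]_26.
    by apply/matrixP => i j; rewrite !mxE big_ord1 !mxE mulr1.
  have Dl : map_mx intr l = z%:~R *: const_mx 1 :> 'rV['Z_27]_26.
    apply/rowP => j; rewrite !mxE rmorphD !rmorphM /= R0 !mul0r addr0.
    by rewrite rmorph1.
  have c1 n' p : map_mx intr (const_mx 1) = const_mx 1 :> 'M['Z_27]_(n', p).
    by apply/matrixP => i j; rewrite !mxE.
  rewrite map_mxM DY -map_mxM mulmxDr mulmx1 mulmxA fixC0 -scalemxAl.
  rewrite map_mxD map_mxZ map_mxM Dl c1 -scalemxAr J scalerA -rmorphM.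
  rewrite !CE !map_mxD !map_mxZ c1 -addrA -scalerDl; congr (_ + _ *: _).
  rewrite mulrA rmorphM /= s0K1 mul1r -rmorphD; congr (_%:~R).
  by rewrite [LHS]addrC; exact: (@subrK _ m0 m).
exists (\matrix_(i, j) ((M i j - C m i j) %/ 27)%Z); rewrite -[RHS]detM; congr (\det _).
set E := _ *: _; suff -> : E = M - C m by rewrite -/(C m) addrC subrK.
apply/matrixP => i j; rewrite [LHS]mxE [X in _ * X]mxE [RHS]mxE [(- C m) i j]mxE.
have dvd27 : (27 %| M i j - C m i j)%Z.
  apply: dvdz_intr_Zp; first exact: isT.
  have /matrixP/(_ i j) := MC; rewrite [LHS]mxE [RHS]mxE => MCij.
  rewrite rmorphB; apply/eqP; rewrite subr_eq0; exact/eqP.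
rewrite mulrC; exact: divzK dvd27.
Qed.

(** * Group ring elements with prescribed blocks *)

Lemma horner_cycmx_circulant (R : comNzRingType) n (p : {poly R}) :
  exists c : nat -> R, forall i j : 'I_n.+1,
    horner_mx (cycmx R n) p i j = c ((i + n.+1 - j) %% n.+1)%N.
Proof.
exists (fun k => \sum_(l < size p) p`_l * (k == l %[mod n.+1])%:R) => i j.
rewrite -{1}[p]coefK poly_def rmorph_sum /= summxE; apply: eq_bigr => l _.
rewrite linearZ /= rmorphXn /= horner_mx_X cycmxX !mxE modn_mod.
by rewrite -[in RHS](eqn_modDl j) subnKC ?modnDr // ltnW // ltn_addl.
Qed.

Lemma sum_units (F : finFieldType) (R : nmodType) (G : F -> R) :
  \sum_(h : {unit F}) G (val h) = \sum_(x | x != 0) G x.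
Proof.
rewrite [RHS](reindex_onto (fun h : {unit F} => val h) (insubd (1%g : {unit F}))).
  apply: eq_bigl => h; rewrite /insubd valK eqxx andbT.
  by rewrite -unitfE (valP h).
by move=> x x_neq0; rewrite insubdK // -[_ \in _]/(x \is a GRing.unit) unitfE.
Qed.

Section Realization.
Variables (F : finFieldType) (psi : F -> algC) (n : nat) (e : 'I_n -> {unit F}).
Hypotheses (psiP : nontrivial_character psi) (e_bij : bijective e).
Variables (c : {unit F} -> int) (N : 'M[int]_n).

(* Besides c, placed on the complement, this adds N t z copies of S_t - S, where S_t and S
   are the sums over h of the maps y |-> h (y - e z) + e t and y |-> h (y - e z). *)
Definition realizer (h : {unit F}) (b : F) : int :=
  c h *+ (b == 0) + \sum_t \sum_z N t z *
    ((b == val (e t) - val h * val (e z))%:R - (b == - (val h * val (e z)))%:R).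

Let C : 'M[int]_n := \matrix_(i, j) c (e i * (e j)^-1)%g.

Lemma sum_delta (R : pzRingType) (b0 : F) (G : F -> R) :
  \sum_b (b == b0)%:R * G b = G b0.
Proof.
rewrite (bigD1 b0) //= eqxx mul1r big1 ?addr0 // => b /negbTE ->.
by rewrite mul0r.
Qed.

(** The two indicator functions attached to each entry of [N] have equal sums over [b], so their
    difference disappears. *)
Lemma abelianized_realizer : abelianized_mx e realizer = C.
Proof.
apply/matrixP => i j; rewrite !mxE big_split /=.
have sum1 (b0 : F) : \sum_b (b == b0)%:R = 1 :> int.
  have := sum_delta b0 (fun=> 1 : int).
  by under eq_bigr do rewrite mulr1.
rewrite -[RHS]addr0; congr (_ + _).
  rewrite -[RHS](sum_delta 0 (fun _ : F => c (e i * (e j)^-1)%g)).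
  by apply: eq_bigr => b _; rewrite mulr_natl.
rewrite exchange_big big1 //= => t _.
rewrite exchange_big big1 //= => z _.
by rewrite -mulr_sumr sumrB !sum1 subrr mulr0.
Qed.

(** The block is [CC + X *m NC *m Y], where [Y] commutes with [CC] and [Y *m X] is the scalar
    [#|F|]. Moving [Y] across from the left turns the block into [CC] plus [#|F|] times [NC]. *)
Lemma det_isotypic_realizer :
  \det (isotypic_mx psi e realizer 1) = (\det (C + #|F|%:Z *: N))%:~R.
Proof.
pose X : 'M[algC]_n := \matrix_(i, t) (psi (val (e t) / val (e i)) - 1).
pose Y : 'M[algC]_n := \matrix_(z, j) psi (- (val (e z) / val (e j))).
pose CC := map_mx intr C : 'M[algC]_n; pose NC := map_mx intr N : 'M[algC]_n.
have sum_e (G : {unit F} -> algC) : \sum_i G (e i) = \sum_h G h.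
  by rewrite [RHS](reindex e) //; apply: onW_bij.
have e_neq0 i : val (e i) != 0 by rewrite -unitfE (valP (e i)).
have isoE : isotypic_mx psi e realizer 1 = CC + X *m NC *m Y.
  apply/matrixP => i j; rewrite !mxE.
  have realizerE b : (realizer (e i * (e j)^-1)%g (val (e i) * b))%:~R =
      (b == 0)%:R * (c (e i * (e j)^-1)%g)%:~R + \sum_t \sum_z (N t z)%:~R *
      ((b == val (e t) / val (e i) - val (e z) / val (e j))%:R -
       (b == - (val (e z) / val (e j)))%:R) :> algC.
    have eqM x : (val (e i) * b == x) = (b == (val (e i))^-1 * x).
      by rewrite -(inj_eq (mulfI (e_neq0 i)) b) mulVKf.
    rewrite rmorphD rmorphMn mulr_natl /= eqM mulr0; congr (_ + _).
    rewrite rmorph_sum; apply: eq_bigr => t _; rewrite rmorph_sum; apply: eq_bigr => z _.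
    rewrite rmorphM rmorphB !rmorph_nat !eqM; congr (_ * ((b == _)%:R - (b == _)%:R)).
      by rewrite /=; field; apply/andP; split; apply: e_neq0.
    by rewrite /=; field; apply/andP; split; apply: e_neq0.
  under eq_bigr => b _ do rewrite realizerE mulr1 mulrDl.
  rewrite big_split /=; congr (_ + _).
    under eq_bigr do rewrite -mulrA.
    by rewrite (sum_delta 0 (fun b => _ * psi b)) (character0 psiP) mulr1.
  under eq_bigr do rewrite mulr_suml.
  under [RHS]eq_bigr do rewrite !mxE mulr_suml.
  rewrite exchange_big [RHS]exchange_big; apply: eq_bigr => t _ /=.
  under eq_bigr do rewrite mulr_suml.
  rewrite exchange_big; apply: eq_bigr => z _ /=; rewrite !mxE.
  under eq_bigr do rewrite -mulrA mulrBl.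
  rewrite -mulr_sumr sumrB !sum_delta (characterD psiP).
  by rewrite -{2}[psi (- _)]mul1r -mulrBl mulrA [_%:~R * _]mulrC.
have YX : Y *m X = #|F|%:R%:M.
  apply/matrixP => z t; rewrite !mxE.
  pose G (x : F) := psi (- (x * val (e z))) * (psi (x * val (e t)) - 1).
  transitivity (\sum_(h : {unit F}) G (val h)).
    transitivity (\sum_i G (val (e i)^-1%g)).
      by apply: eq_bigr => i _; rewrite !mxE /G /= ![_^-1 * _]mulrC.
    rewrite (sum_e (fun h => G (val h^-1%g))) [RHS](reindex_inj invg_inj).
    by apply: eq_bigr.
  (* The -1 in [X] makes the summand vanish at 0, so the sum over units extends to all of [F] and
     orthogonality applies. *)
  rewrite sum_units; have -> : \sum_(x | x != 0) G x = \sum_x G x.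
    by rewrite [RHS](bigD1 0) //= /G !mul0r (character0 psiP) subrr mulr0 add0r.
  rewrite /G; under eq_bigr do rewrite mulrBr mulr1 mulrC.
  rewrite sumrB (character_orthogonality psiP).
  under [X in _ - X]eq_bigr do rewrite -mulrN.
  rewrite (sum_characterM psiP) oppr_eq0 (negbTE (e_neq0 z)) muln0 subr0.
  rewrite (inj_eq val_inj) (inj_eq (bij_inj e_bij)) eq_sym.
  by case: (z == t); rewrite ?muln1 ?muln0 ?mulr1n ?mulr0n.
have YC : Y *m CC = CC *m Y.
  apply/matrixP => z j; rewrite !mxE.
  pose G (h : {unit F}) := (c (h * (e j)^-1)%g)%:~R * psi (- val (e z * h^-1)%g).
  transitivity (\sum_h G h).
    by rewrite -sum_e; apply: eq_bigr => i _; rewrite !mxE mulrC.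
  (* In the commutative group [F^*] this substitution exchanges the arguments of [c] and [psi] up to
     inversion, turning one convolution into the other. *)
  rewrite (reindex_inj (_ : injective (fun h => e z * h^-1 * e j)%g)) /=.
    rewrite -sum_e; apply: eq_bigr => i _; rewrite !mxE /G mulgK.
    congr (_ * psi (- _)); rewrite /=; field.
    by do ?[apply/andP; split]; apply: e_neq0.
  by move=> h k /mulIg /mulgI /invg_inj.
have detY : \det Y != 0.
  have : \det (Y *m X) != 0.
    by rewrite YX det_scalar expf_neq0 // pnatr_eq0 -lt0n; apply/card_gt0P; exists 0.
  by rewrite det_mulmx mulf_eq0 negb_or => /andP[].
apply: (mulfI detY); rewrite isoE -det_mulmx mulmxDr YC !mulmxA YX.
rewrite mul_scalar_mx -mulmxDl det_mulmx mulrC; congr (_ * _).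
by rewrite -det_map_mx map_mxD map_mxZ.
Qed.

End Realization.

(** * Enumeration of the unit group and the two implications *)

Section Cyclic.
Variables (F : finFieldType) (n : nat).
Hypothesis cardF : #|F| = n.+2.

(** Listing the units as powers of a generator makes the group matrices of [F^*] circulants. *)
Lemma exists_unit_enum : exists2 e : 'I_n.+1 -> {unit F}, bijective e &
  forall i j k : 'I_n.+1, (k = (i + n.+1 - j) %% n.+1 :> nat)%N -> (e i * (e j)^-1)%g = e k.
Proof.
have cardU : #|[set: {unit F}]| = n.+1 by rewrite card_finField_unit cardF.
have /cyclicP[g Dg] : cyclic [set: {unit F}] by apply: field_unit_group_cyclic.
have ord_g : #[g]%g = n.+1 by rewrite orderE -Dg cardU.
exists (fun i : 'I_n.+1 => (g ^+ i)%g).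
  apply: inj_card_bij; last by rewrite card_ord -cardsT cardU.
  move=> i j /eqP; rewrite eq_expg_mod_order ord_g !modn_small // => /eqP.
  exact: val_inj.
move=> i j k ->; apply: (mulIg (g ^+ j)%g); rewrite mulgKV -expgD.
apply/eqP; rewrite eq_expg_mod_order ord_g modnDml subnK ?modnDr //.
by rewrite ltnW // ltn_addl.
Qed.
End Cyclic.

Theorem theorem6 (F : finFieldType) (hF : #|F| = 27%N) (D : int) :
  is_int_group_det (GA1 F) D <->
  exists A B : int,
    [/\ D = A * B ^+ 26,
        (B = A %[mod 27])%Z,
        ((2 %| A)%Z -> (4 %| A)%Z) &
        ((13 %| A)%Z -> (13 ^+ 2 %| A)%Z)].
Proof.
have [psi psiP] := exists_nontrivial_character F.
have [e e_bij eV] := exists_unit_enum hF.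
split=> [[a ->] | [A [B [-> BA A2 A13]]]].
  pose al h b := a (aff h b); pose A := \det (abelianized_mx e al).
  have [d Dd] := det_isotypic_cong psiP e_bij al.
  exists A, (A - 27%:Z * d).
  pose c k := \sum_b al (e (inord k)) b.
  have DA : A = circ 25 (\poly_(k < 26) c k).
    rewrite -circ_poly; congr (\det _); apply/matrixP => i j; rewrite !mxE /c.
    by rewrite (eV _ _ (inord ((i + 26 - j) %% 26))) // inordK ?ltn_pmod.
  have [dvd2 dvd13] := circ26_dvd (\poly_(k < 26) c k).
  split; try by rewrite DA.
    apply: (intr_inj (R := algC)).
    by rewrite (int_group_det_GA1 psiP e_bij) Dd hF rmorphM rmorphXn.
  apply/eqP; rewrite eqz_mod_dvd addrAC subrr add0r -mulrN.
  by rewrite dvdz_mulr.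
have [u [m [K [uK coK DA]]]] := exists_circ_slope A2 A13.
have BE : (B = (u.[1] + 26 * m) * K %[mod 27])%Z by rewrite -DA.
have [N detN] := lift_circ_slope uK coK BE.
have [c cE] := horner_cycmx_circulant 25 (u + m%:P * geom int 26).
have [d ed de] := e_bij.
pose c' (h : {unit F}) := c (d h).
have CE : \matrix_(i, j) c' (e i * (e j)^-1)%g =
    horner_mx (cycmx int 25) (u + m%:P * geom int 26).
  apply/matrixP => i j; rewrite mxE cE /c' (eV _ _ (inord ((i + 26 - j) %% 26))).
    by rewrite ed inordK ?ltn_pmod.
  by rewrite inordK ?ltn_pmod.
(* The first block becomes the circulant of determinant [A], the other one its perturbation by
   [27 N], of determinant [B]. *)
exists (fun g => realizer e c' N (lin_part g) (trans_part g)).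
apply: (intr_inj (R := algC)); rewrite (int_group_det_GA1 psiP e_bij) hF.
set al := fun h b => _.
have Eal h b : al h b = realizer e c' N h b by rewrite /al lin_part_aff trans_part_aff.
have -> : abelianized_mx e al = abelianized_mx e (realizer e c' N).
  by apply/matrixP => i j; rewrite !mxE; apply: eq_bigr => b _; rewrite Eal.
have -> : isotypic_mx psi e al 1 = isotypic_mx psi e (realizer e c' N) 1.
  by apply/matrixP => i j; rewrite !mxE; apply: eq_bigr => b _; rewrite Eal.
rewrite abelianized_realizer (det_isotypic_realizer psiP e_bij) hF CE detN.
rewrite -/(circ 25 _) uK -DA rmorphM rmorphXn.
by [].
Qed.
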